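(* Suppose all costs satisfy $c_x>1$ and let $\rho\ge 0$. Let $\mathcal{G}^*$ be a guessing strategy minimizing $\mathbb{E}[C_{\mathcal{G}}(X)^\rho]$ over all guessing strategies, and let $c_1^*,\dots,c_M^*$ be the costs listed in the order in which $\mathcal{G}^*$ guesses, i.e. $c_i^*=c_{(\mathcal{G}^* )^{-1}(i)}$. Let $\gamma^*$ be the harmonic mean of the $M$ numbers $\sum_{j=1}^i c_j^*-1$, $i=1,\dots,M$. Then for any guessing strategy $\mathcal{G}$, $$\mathbb{E}[C_{\mathcal{G}}(X)^\rho]\ge\mathbb{E}[C_{\mathcal{G}^*}(X)^\rho]\ge\left(\frac{M}{1+\gamma^*}\right)^{-\rho}\exp\left\{\rho H_{\frac{1}{1+\rho}}(X)\right\}.$$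
   Context: $X$ is a random variable on a finite set $\mathcal{X}$ with $|\mathcal{X}|=M$ and distribution $P_X$; each $x\in\mathcal{X}$ has a fixed real cost $c_x$. A guessing strategy is a bijection $\mathcal{G}:\mathcal{X}\to\{1,\dots,M\}$. The guessing cost is $C_{\mathcal{G}}(x)=\sum_{j=1}^{\mathcal{G}(x)}c_{\mathcal{G}^{-1}(j)}$, so $\mathbb{E}[C_{\mathcal{G}}(X)^\rho]=\sum_{i=1}^M P_X(\mathcal{G}^{-1}(i))\left[\sum_{j=1}^i c_{\mathcal{G}^{-1}(j)}\right]^\rho$. The Rényi entropy of order $\alpha>0$, $\alpha\ne1$, is $H_\alpha(X)=\frac{\alpha}{1-\alpha}\ln\left[\sum_x P_X(x)^\alpha\right]^{1/\alpha}=\frac{1}{1-\alpha}\ln\sum_x P_X(x)^\alpha$; $H_1(X)$ is the Shannon entropy (natural logarithm). *)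

(* Defs.v *)
From HB Require Import structures.
From mathcomp Require Import all_boot all_order all_algebra.
From mathcomp Require Import reals sequences exp.

Set Implicit Arguments.
Unset Strict Implicit.
Unset Printing Implicit Defensive.

Import Order.TTheory GRing.Theory Num.Theory.

Local Open Scope ring_scope.

(* A bijection from T onto the positions 1, ..., #|T|, together with its
   inverse.  Positions are 0-based ordinals: the i-th guess of the usual 1-based
   numbering has index i - 1, so that guessing x takes (position G x).+1
   guesses. *)
Record strategy (T : finType) := Strategy {
  position :> T -> 'I_#|T|;
  guess : 'I_#|T| -> T;
  positionK : cancel position guess;
  guessK : cancel guess position }.

Section Guessing.
Context {R : realType} {T : finType}.
Implicit Types (P c : T -> R) (G : strategy T) (rho alpha : R).

Definition is_distribution P := (forall x, 0 <= P x) /\ \sum_x P x = 1.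

(* Cost of the first i.+1 guesses of G, for i < #|T|. *)
Definition cumulative_cost c G (i : nat) : R :=
  \sum_(j < #|T| | (j <= i)%N) c (guess G j).

Definition guessing_cost c G (x : T) : R := cumulative_cost c G (G x).

Definition expectation P (f : T -> R) : R := \sum_x P x * f x.

Definition cost_moment P c rho G : R :=
  expectation P (fun x => guessing_cost c G x `^ rho).

Definition optimal_strategy P c rho G :=
  forall G', cost_moment P c rho G <= cost_moment P c rho G'.

(* Terms with P x = 0 vanish: ln 0 = 0 and 0 `^ alpha = 0 for alpha != 0. *)
Definition renyi_entropy alpha P : R :=
  if alpha == 1 then - \sum_x P x * ln (P x)
  else (1 - alpha)^-1 * ln (\sum_x P x `^ alpha).

(* [harmonic_mean u n] averages the n.+1 terms u 0, ..., u n, so index #|T|.-1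
   ranges over all #|T| positions of the strategy (T nonempty). *)
Definition shifted_cost_mean c G : R :=
  harmonic_mean (fun i => cumulative_cost c G i - 1) #|T|.-1.

End Guessing.

(* Main.v *)
Require Import Defs.
From mathcomp Require Import all_boot all_order all_algebra.
From mathcomp Require Import reals sequences exp.
From mathcomp Require Import ring lra.

Import Order.TTheory GRing.Theory Num.Theory.

Local Open Scope ring_scope.

(** Put [a_i = c*_1 + ... + c*_i > 1]. Hoelder's inequality with exponents
    [1 + rho] and [(1 + rho) / rho], applied to
    [P^(1/(1+rho)) = (P a^rho)^(1/(1+rho)) (a^-1)^(rho/(1+rho))], bounds
    [exp (rho H)] by [E[C^rho] (sum_i 1/a_i)^rho]. Since [1/a = t / (1 + t)] for
    [t = 1/(a - 1)], and [t / (1 + t)] is concave in [t], Jensen's inequality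
    gives [sum_i 1/a_i <= M / (1 + gamma)]. *)

(** Young's inequality is applied to each term once [u] and [v] are divided by their sums; [s] and
    [t] are the reciprocals of the conjugate exponents. *)
Lemma sum_powR_hoelder (R : realType) (I : finType) (u v : I -> R) (s t : R) :
  (forall i, 0 <= u i) -> (forall i, 0 <= v i) ->
  0 < s -> 0 < t -> s + t = 1 ->
  \sum_i u i `^ s * v i `^ t <= (\sum_i u i) `^ s * (\sum_i v i) `^ t.
Proof.
move=> u0 v0 s0 t0 st.
have ge0U : 0 <= \sum_i u i by apply: sumr_ge0.
have ge0V : 0 <= \sum_i v i by apply: sumr_ge0.
(* A zero sum of nonnegative terms kills every term, and zero to a positive power is zero. *)
have [U0|U0] := eqVneq (\sum_i u i) 0.
  rewrite big1 ?mulr_ge0 ?powR_ge0// => i _.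
  by rewrite (psumr_eq0P (fun i _ => u0 i) U0)// powR0 ?mul0r// gt_eqF.
have [V0|V0] := eqVneq (\sum_i v i) 0.
  rewrite big1 ?mulr_ge0 ?powR_ge0// => i _.
  by rewrite (psumr_eq0P (fun i _ => v0 i) V0)// powR0 ?mulr0// gt_eqF.
set U := \sum_i u i in ge0U U0 *; set V := \sum_i v i in ge0V V0 *.
have gt0U : 0 < U by rewrite lt0r U0.
have gt0V : 0 < V by rewrite lt0r V0.
have young i : u i `^ s * v i `^ t <=
    U `^ s * V `^ t * (s * (u i / U) + t * (v i / V)).
  have := @conjugate_powR _ ((u i / U) `^ s) ((v i / V) `^ t) s^-1 t^-1.
  rewrite !powR_ge0 !invr_gt0 s0 t0 !invrK st => /(_ isT isT isT isT erefl).
  rewrite -!powRrM !divff ?gt_eqF// !powRr1 ?divr_ge0// (mulrC _ s) (mulrC _ t).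
  move=> /(ler_wpM2l (mulr_ge0 (powR_ge0 U s) (powR_ge0 V t))).
  apply: le_trans; rewrite mulrACA -!powRM ?divr_ge0//.
  by rewrite (mulrCA U) (mulrCA V) !divff// !mulr1.
apply: le_trans (ler_sum _ (fun i _ => young i)) _.
(* Each normalised family sums to 1, which leaves the factor [s + t = 1]. *)
rewrite -mulr_sumr big_split/= -!mulr_sumr -!mulr_suml !divff//.
by rewrite !mulr1 st mulr1.
Qed.

(** Since [h] is the harmonic mean of the [b i], the linear terms of the tangent bounds cancel in
    the sum. *)
Lemma sum_invr_add1_le (R : realFieldType) (I : finType) (b : I -> R) (h : R) :
  (forall i, 0 < b i) -> 0 < h -> \sum_i (b i)^-1 = #|I|%:R / h ->
  \sum_i (1 + b i)^-1 <= #|I|%:R / (1 + h).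
Proof.
move=> b0 h0 bh.
(* Tangent line of [t / (1 + t)] at [t = 1 / h], evaluated at [t = 1 / b i] *)
have tangent i : (1 + b i)^-1 <=
    (1 + h)^-1 + ((b i)^-1 - h^-1) * (h / (1 + h)) ^+ 2.
  have bi := b0 i; rewrite -subr_ge0.
  have -> : (1 + h)^-1 + ((b i)^-1 - h^-1) * (h / (1 + h)) ^+ 2 - (1 + b i)^-1 =
      (h - b i) ^+ 2 / ((1 + h) ^+ 2 * b i * (1 + b i)).
    by field; rewrite !gt_eqF//; lra.
  by rewrite divr_ge0 ?sqr_ge0// !mulr_ge0 ?sqr_ge0//; lra.
apply: le_trans (ler_sum _ (fun i _ => tangent i)) _.
rewrite big_split/= -mulr_suml big_split/= bh !sumr_const.
by rewrite mulNrn -[_^-1 *+ _]mulr_natl -[h^-1 *+ _]mulr_natl subrr mul0r addr0.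
Qed.

Section GuessingCosts.
Context {R : realType} {T : finType}.
Variables (P c : T -> R) (G : strategy T).
Hypothesis hc : forall x, 1 < c x.

Lemma cumulative_cost_gt1 (i : 'I_#|T|) : 1 < cumulative_cost c G i.
Proof.
rewrite /cumulative_cost (bigD1 i)//=; apply: ltr_wpDr => //.
by apply: sumr_ge0 => j _; exact: ltW (lt_trans ltr01 (hc _)).
Qed.

Lemma sum_guess (f : 'I_#|T| -> R) : \sum_x f (G x) = \sum_i f i.
Proof.
by rewrite [RHS](reindex G)//; exists (guess G) => x _; rewrite ?positionK ?guessK.
Qed.

Lemma shifted_cost_meanE : (0 < #|T|)%N ->
  shifted_cost_mean c G = #|T|%:R / \sum_(i < #|T|) (cumulative_cost c G i - 1)^-1.
Proof.
by move=> T0; rewrite /shifted_cost_mean /harmonic_mean /series/= prednK// big_mkord.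
Qed.

(** After reindexing by position, this is [sum_invr_add1_le] with [b i] the cumulative cost minus 1,
    positive since each cost exceeds 1. *)
Lemma sum_inv_guessing_cost_le : (0 < #|T|)%N ->
  0 < 1 + shifted_cost_mean c G /\
  \sum_x (guessing_cost c G x)^-1 <= #|T|%:R / (1 + shifted_cost_mean c G).
Proof.
move=> T0; rewrite shifted_cost_meanE//.
set S := \sum_(i < _) _.
have b0 (i : 'I_#|T|) : 0 < cumulative_cost c G i - 1.
  by rewrite subr_gt0 cumulative_cost_gt1.
have S0 : 0 < S.
  rewrite /S (bigD1 (Ordinal T0))//=; apply: ltr_wpDr.
    by apply: sumr_ge0 => i _; rewrite invr_ge0 ltW.
  by rewrite invr_gt0 (b0 (Ordinal T0)).
have M0 : 0 < #|T|%:R :> R by rewrite ltr0n.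
have h0 : 0 < #|T|%:R / S by rewrite divr_gt0.
split; first by rewrite addr_gt0.
rewrite /guessing_cost (sum_guess (fun i => (cumulative_cost c G i)^-1)).
have Sh : S = #|'I_#|T| |%:R / (#|T|%:R / S).
  by rewrite card_ord invf_div mulrC divfK// gt_eqF.
have := sum_invr_add1_le _ _ _ _ b0 h0 Sh.
by rewrite card_ord; under eq_bigr do rewrite subrKC.
Qed.

Hypothesis hP : is_distribution P.

Lemma card_distribution_gt0 : (0 < #|T|)%N.
Proof.
rewrite lt0n; apply/eqP => /card0_eq T0.
case: hP => _ /eqP; rewrite big1 ?(eq_sym 0) ?oner_eq0// => x.
by have := T0 x; rewrite inE.
Qed.

(** For alpha = 1/(1 + rho) one has rho/(1 - alpha) = 1 + rho; [0 < rho] rules out the Shannon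
    branch. *)
Lemma expR_renyi_entropy (rho : R) : 0 < rho ->
  expR (rho * renyi_entropy (1 / (1 + rho)) P) =
  (\sum_x P x `^ (1 + rho)^-1) `^ (1 + rho).
Proof.
move=> rho0; have [P0 P1] := hP.
have r0 : 1 + rho != 0 by rewrite gt_eqF// addr_gt0.
(* [powR] is [expR] of a multiple of [ln] only at a nonzero base; a zero sum would force [P] to
   vanish everywhere. *)
have Z0 : 0 < \sum_x P x `^ (1 + rho)^-1.
  rewrite lt0r sumr_ge0 ?andbT => [|x _]; last exact: powR_ge0.
  apply/eqP => Z0; have /eqP : \sum_x P x = 0.
    apply: big1 => x _; apply: powR_eq0_eq0.
    exact: (psumr_eq0P (fun x _ => powR_ge0 (P x) _) Z0).
  by rewrite P1 oner_eq0.
rewrite /renyi_entropy div1r ifF; last first.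
  by rewrite invr_eq1 -subr_eq0 addrC addKr gt_eqF.
set Z := \sum_x _ in Z0 *.
rewrite /powR gt_eqF// mulrA; congr (expR (_ * _)).
by field; rewrite r0 gt_eqF//; lra.
Qed.

Lemma expR_renyi_entropy_le (rho : R) : 0 < rho ->
  expR (rho * renyi_entropy (1 / (1 + rho)) P) <=
  cost_moment P c rho G * (\sum_x (guessing_cost c G x)^-1) `^ rho.
Proof.
move=> rho0; rewrite expR_renyi_entropy//.
have [P0 _] := hP.
have r0 : 0 < 1 + rho by rewrite addr_gt0.
set a := guessing_cost c G.
have a0 x : 0 < a x := lt_trans ltr01 (cumulative_cost_gt1 (G x)).
have u0 x : 0 <= P x * a x `^ rho by rewrite mulr_ge0 ?powR_ge0.
have v0 x : 0 <= (a x)^-1 by rewrite invr_ge0 ltW.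
have := @sum_powR_hoelder R T _ _ (1 + rho)^-1 (rho / (1 + rho)) u0 v0.
rewrite invr_gt0 divr_gt0// => /(_ r0 isT) hoelder.
have /hoelder {}hoelder : (1 + rho)^-1 + rho / (1 + rho) = 1.
  by rewrite -[X in X + _]mul1r -mulrDl divff// gt_eqF.
(* The two powers of [a x] have opposite exponents and cancel. *)
have E x : (P x * a x `^ rho) `^ (1 + rho)^-1 * (a x)^-1 `^ (rho / (1 + rho)) =
    P x `^ (1 + rho)^-1.
  rewrite powRM ?powR_ge0// -powRrM -mulrA -powRM ?powR_ge0//; last exact: ltW.
  by rewrite divff ?gt_eqF// powR1 mulr1.
rewrite (eq_bigr _ (fun x _ => E x)) in hoelder.
(* Raising to the power [1 + rho] turns the Hoelder exponents into 1 and [rho]. *)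
have := ge0_ler_powR (ltW r0) _ _ hoelder.
rewrite !nnegrE sumr_ge0 ?mulr_ge0 ?powR_ge0// => [|x _]; last exact: powR_ge0.
move=> /(_ isT isT)/le_trans; apply.
rewrite powRM ?powR_ge0// -!powRrM mulVf ?divfK ?gt_eqF//.
by rewrite powRr1// sumr_ge0.
Qed.

End GuessingCosts.

Theorem theorem3p1 (R : realType) (T : finType) (P c : T -> R) (rho : R)
    (Gstar : strategy T) (gamma : R)
    (hP : is_distribution P)
    (hc : forall x, 1 < c x)
    (hrho : 0 <= rho)
    (hGstar : optimal_strategy P c rho Gstar)
    (hgamma : gamma = shifted_cost_mean c Gstar) :
  forall G : strategy T,
    cost_moment P c rho G >= cost_moment P c rho Gstar /\
    cost_moment P c rho Gstar >=
      (#|T|%:R / (1 + gamma)) `^ (- rho) *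
      expR (rho * renyi_entropy (1 / (1 + rho)) P).
Proof.
move=> G; split; first exact: hGstar.
(* At [rho = 0] the entropy has order 1, outside the formula above, but both sides equal 1. *)
move: hrho; rewrite le_eqVlt => /predU1P[<-|rho0].
  rewrite oppr0 powRr0 mul0r expR0 mul1r /cost_moment /expectation.
  by under eq_bigr do rewrite powRr0 mulr1; case: hP => _ ->.
have T0 := card_distribution_gt0 _ hP.
have [g0 leS] := sum_inv_guessing_cost_le c Gstar hc T0.
(* The negative power moves across as a positive factor, so it remains to bound the sum of inverse
   costs inside a [rho]-th power. *)
rewrite hgamma powRN mulrC ler_pdivrMr; last by rewrite powR_gt0 ?divr_gt0 ?ltr0n.
apply: le_trans (expR_renyi_entropy_le P c Gstar hc hP rho rho0) _.
have a0 x : 0 <= (guessing_cost c Gstar x)^-1.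
  by rewrite invr_ge0 ltW// (lt_trans ltr01)// cumulative_cost_gt1.
apply: ler_wpM2l.
  by apply: sumr_ge0 => x _; rewrite mulr_ge0 ?powR_ge0//; case: hP.
apply: ge0_ler_powR => //; first exact: ltW.
- by rewrite nnegrE sumr_ge0.
- by rewrite nnegrE divr_ge0 ?ler0n// ltW.
Qed.
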